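(* Let $S$ be a finite nonabelian simple group, and let $G$ be a finitely generated group in $\mathcal{V}=\mathrm{Var}(S)$. Then there exist an integer $n\ge 0$ and a group $K\in\mathcal{U}$ such that $$G\cong S^n\times K,$$ where $\mathcal{U}=\mathrm{Var}\bigl((\mathbf{HS}-1)(S)\bigr)$.
   Context: A variety of groups is a class of groups closed under taking quotients, subgroups and arbitrary direct products. For a group (or a collection of groups) $X$, $\mathrm{Var}(X)$ denotes the variety generated by $X$, i.e. the smallest variety containing $X$. A subfactor of a group $G$ is any group of the form $H/N$ where $H$ is a subgroup of $G$ and $N\triangleleft H$; it is called proper except in the case where $H=G$ and $N=\{e\}$. $(\mathbf{HS}-1)(G)$ denotes the collection of all proper subfactors of $G$. $S^n$ denotes the direct product of $n$ copies of $S$. *)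

(* Defs.v *)
From HB Require Import structures.
From mathcomp Require Import all_boot all_order all_fingroup all_solvable.
From mathcomp Require Import boolp.

Set Implicit Arguments.
Unset Strict Implicit.
Unset Printing Implicit Defensive.

Local Open Scope group_scope.

(* Unrestricted direct product of an arbitrary family of (possibly infinite)
   groups. The choiceType structure required by groupType comes from boolp. *)
Definition group_product (I : Type) (F : I -> groupType) : Type :=
  forall i, F i.

Section DirectProduct.
Variables (I : Type) (F : I -> groupType).
Local Notation P := (group_product F).
Implicit Types f g h : P.

HB.instance Definition _ := gen_eqMixin P.
HB.instance Definition _ := gen_choiceMixin P.

Definition group_product_one : P := fun i => 1.
Definition group_product_inv f : P := fun i => (f i)^-1.
Definition group_product_mul f g : P := fun i => f i * g i.

Fact group_product_mulA : associative group_product_mul.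
Proof. by move=> f g h; apply: functional_extensionality_dep => i; apply: mulgA. Qed.

Fact group_product_mul1 : left_id group_product_one group_product_mul.
Proof. by move=> f; apply: functional_extensionality_dep => i; apply: mul1g. Qed.

Fact group_product_mulr1 : right_id group_product_one group_product_mul.
Proof. by move=> f; apply: functional_extensionality_dep => i; apply: mulg1. Qed.

Fact group_product_mulV :
  left_inverse group_product_one group_product_inv group_product_mul.
Proof. by move=> f; apply: functional_extensionality_dep => i; apply: mulVg. Qed.

Fact group_product_mulrV :
  right_inverse group_product_one group_product_inv group_product_mul.
Proof. by move=> f; apply: functional_extensionality_dep => i; apply: mulgV. Qed.

HB.instance Definition _ := isGroup.Build P group_product_mulA
  group_product_mul1 group_product_mulr1
  group_product_mulV group_product_mulrV.
End DirectProduct.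

Definition isomorphic (G H : groupType) : Prop :=
  exists f : {multiplicative G -> H}, bijective f.

(* Quotients and subgroups are taken up to isomorphism, i.e. as targets of
   surjective and sources of injective homomorphisms; in particular a variety
   is closed under isomorphism. *)
Record variety (C : groupType -> Prop) : Prop := Variety {
  variety_quotient : forall (G Q : groupType) (f : {multiplicative G -> Q}),
    (forall y, exists x, f x = y) -> C G -> C Q;
  variety_subgroup : forall (G H : groupType) (f : {multiplicative H -> G}),
    injective f -> C G -> C H;
  variety_product : forall (I : Type) (F : I -> groupType),
    (forall i, C (F i)) -> C (group_product F)
}.

Definition Var (X : groupType -> Prop) (G : groupType) : Prop :=
  forall C : groupType -> Prop,
    variety C -> (forall H, X H -> C H) -> C G.

(* [subg H / N] is the subset H / N of coset_of N turned into a group type. *)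
Definition proper_subfactor (S : finGroupType) (Q : groupType) : Prop :=
  exists H N : {group S},
    [/\ N <| H, ~ (H :=: [set: S] /\ N :=: 1)
      & isomorphic Q [subg H / N]%type].

Definition finitely_generated (G : groupType) : Prop :=
  exists s : seq G, forall H : {pred G},
    group_closed H -> {subset s <= H} -> forall x, x \in H.

(* Main.v *)
(* Since G is finitely generated and satisfies the laws of S, it is a quotient
   H / N of a subgroup H of a finite power S ^ I, and H can be chosen minimal
   among the subgroups covering G. Let K_i be the kernel of the i-th coordinate
   on H, and call i good if that coordinate maps H onto S. Minimality of H gives
   N <= K_i for every good i. Let D be the intersection of the good K_i and L
   that of the other ones, so that L and D meet trivially. The good kernels
   behave like prime ideals, and comparing orders shows that a bad K_i is never
   contained in a good one; hence L maps onto a power of S with kernel L :&: D,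
   through enough good coordinates, and H = L x D. So G is L x (D / N) with L
   a power of S, and D embeds in a product of proper subgroups of S. *)
Require Import Defs.
From HB Require Import structures.
From mathcomp Require Import all_boot all_order all_fingroup all_solvable.
From mathcomp Require Import boolp.

Set Implicit Arguments.
Unset Strict Implicit.
Unset Printing Implicit Defensive.

Local Open Scope group_scope.

(** * Words, laws, and passage to a section of a finite power *)

HB.instance Definition _ (I : finType) (S : finGroupType) :=
  Finite.on {ffun I -> S}.

(** Division is the only operation, matching the closure condition of [group_closed]; inverses and
    products are recovered with the help of [One]. *)
Inductive word (T : Type) :=
  Letter of T | One | Div of word T & word T.
Arguments One {T}.

Fixpoint eval (T : Type) (G : groupType) (v : T -> G) (w : word T) : G :=
  match w with
  | Letter i => v i
  | One => 1
  | Div w1 w2 => eval v w1 * (eval v w2)^-1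
  end.

Lemma multiplicative1 (G H : groupType) (f : {multiplicative G -> H}) : f 1 = 1.
Proof. by apply: (mulgI (f 1)); rewrite -gmulfM !mulg1. Qed.

Lemma multiplicativeV (G H : groupType) (f : {multiplicative G -> H}) :
  {morph f : x / x^-1}.
Proof.
by move=> x; apply/divg1_eq; rewrite invgK -gmulfM mulVg multiplicative1.
Qed.

Definition multiplicative_of (G H : groupType) (f : G -> H)
    (fM : {morph f : x y / x * y}) : {multiplicative G -> H} :=
  HB.pack f (isMultiplicative.Build _ _ f fM).

Lemma eval_morph (T : Type) (G H : groupType) (f : {multiplicative G -> H})
    (v : T -> G) w : f (eval v w) = eval (f \o v) w.
Proof.
elim: w => [i||w1 IH1 w2 IH2] //=; first exact: multiplicative1.
by rewrite gmulfM multiplicativeV IH1 IH2.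
Qed.

Lemma eval_ffun (T : Type) (I : finType) (S : groupType)
    (v : T -> {ffun I -> S}) w i : eval v w i = eval (v^~ i) w.
Proof. by elim: w => [j||w1 IH1 w2 IH2] //=; rewrite !ffunE // IH1 IH2. Qed.

Definition satisfies_laws (T : Type) (S G : groupType) : Prop :=
  forall w : word T, (forall v : T -> S, eval v w = 1) ->
  forall u : T -> G, eval u w = 1.

(** Lets membership in [Var] be tested on laws. An assignment in a quotient lifts along a section of
    the surjection; the other two closures follow since evaluation commutes with injections and with
    projections. *)
Lemma variety_laws (T : Type) (S : groupType) : variety (satisfies_laws T S).
Proof.
split=> [G Q f f_surj G_laws w wS u | G H f f_inj G_laws w wS u
        | I F F_laws w wS u].
- have [g gK] := choice f_surj.
  have ->: u = f \o (g \o u) by apply: funext => i /=.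
  by rewrite -eval_morph G_laws ?multiplicative1.
- by apply: f_inj; rewrite eval_morph multiplicative1 G_laws.
- apply: functional_extensionality_dep => i.
  have -> : eval u w i = eval (fun x => u x i) w.
    by elim: {wS} w => //= w1 <- w2 <-.
  exact: F_laws.
Qed.

Lemma laws_eval_eq (T : Type) (S G : groupType) (w1 w2 : word T) (u : T -> G) :
  satisfies_laws T S G -> (forall v : T -> S, eval v w1 = eval v w2) ->
  eval u w1 = eval u w2.
Proof.
move=> G_laws w12; apply: divg1_eq; apply: (G_laws (Div w1 w2)) => v /=.
by rewrite w12 mulgV.
Qed.

(* G is a quotient of the relatively free group of S on the generators of G,
   realized as the group of term functions S ^ k -> S. *)
Lemma fg_laws_finite (S : finGroupType) (G : groupType) :
  finitely_generated G -> (forall k, satisfies_laws 'I_k S G) ->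
  exists (I : finType) (H N : {group {ffun I -> S}}),
    N <| H /\ isomorphic G [subg H / N]%type.
Proof.
case=> s s_gen G_laws.
pose k := size s; pose u := tnth (in_tuple s).
have ev_surj x : exists w, eval u w = x.
  pose P : {pred G} := fun x => `[< exists w, eval u w = x >].
  apply/asboolP/(s_gen P) => [|y y_s].
    split=> [|y z /asboolP[w1 <-] /asboolP[w2 <-]].
      by apply/asboolP; exists One.
    by apply/asboolP; exists (Div w1 w2).
  apply/asboolP.
  have lt_s : (index y s < k)%N by rewrite index_mem.
  by exists (Letter (Ordinal lt_s)); rewrite /= /u (tnth_nth y) /= nth_index.
(* The index set is [S ^ k] itself: [g i] is the [i]-th projection, so [eval g w] is the term
   function of [w]. *)
pose g i : {ffun {ffun 'I_k -> S} -> S} := [ffun v : {ffun 'I_k -> S} => v i].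
have gE w (v : 'I_k -> S) : eval g w (finfun v) = eval v w.
  rewrite eval_ffun; congr eval; apply: funext => i.
  by rewrite !ffunE.
have g_inj w1 w2 : eval g w1 = eval g w2 -> eval u w1 = eval u w2.
  by move=> g12; apply: laws_eval_eq (G_laws k) _ => v; rewrite -!gE g12.
(* [Hs] consists of all term functions, [Ns] of those represented by a word that is trivial in
   [G]. *)
pose Hs := [set x | `[< exists w, eval g w = x >]].
pose Ns := [set x | `[< exists w, eval g w = x /\ eval u w = 1 >]].
have HP x : reflect (exists w, eval g w = x) (x \in Hs).
  by rewrite inE; apply: asboolP.
have NP x : reflect (exists w, eval g w = x /\ eval u w = 1) (x \in Ns).
  by rewrite inE; apply: asboolP.
have gHs : group_set Hs.
  apply/group_setP; split=> [|x y /HP[w1 <-] /HP[w2 <-]]; apply/HP.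
    by exists One.
  by exists (Div w1 (Div One w2)); rewrite /= div1g invgK.
have gNs : group_set Ns.
  apply/group_setP; split=> [|x y /NP[w1 [<- u1]] /NP[w2 [<- u2]]]; apply/NP.
    by exists One.
  by exists (Div w1 (Div One w2)); rewrite /= u1 u2 !mul1g !invgK.
pose H := Group gHs; pose N := Group gNs.
have nNH : N <| H.
  apply/andP; split; apply/subsetP=> x.
    by case/NP=> w [<- _]; apply/HP; exists w.
  case/HP=> wx <-; rewrite inE; apply/subsetP=> _ /imsetP[y /NP[w [<- uw]] ->].
  apply/NP; exists (Div (Div One wx) (Div (Div One wx) w)).
  by rewrite /= conjgE uw !mul1g !invMg !invgK mul1g mulVg.
exists _, H, N; split=> //.
have [r rK] := choice ev_surj.
have gH w : eval g w \in H by apply/HP; exists w.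
have gNorm w : eval g w \in 'N(N) by apply: (subsetP (normal_norm nNH)).
(* The two directions make the map from [G] to cosets injective and independent of the word chosen
   by [r]. *)
have cosetE w1 w2 :
    coset N (eval g w1) = coset N (eval g w2) <-> eval u w1 = eval u w2.
  split=> [/rcoset_kercosetP|uw].
    move=> /(_ (gNorm _) (gNorm _)) /rcosetP[_ /NP[w [<- uw]] gw].
    have /g_inj /= : eval g w1 = eval g (Div w (Div One w2)).
      by rewrite /= mul1g invgK.
    by rewrite uw !mul1g invgK.
  apply/rcoset_kercosetP => //; apply/rcosetP.
  exists (eval g (Div w1 w2)); last by rewrite /= mulgVK.
  by apply/NP; exists (Div w1 w2); rewrite /= uw mulgV.
pose f x : [subg H / N] := subg (H / N) (coset N (eval g (r x))).
have fE x : val (f x) = coset N (eval g (r x)).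
  by rewrite [LHS]subgK // mem_quotient.
have fM : {morph f : x y / x * y}.
  move=> x y; apply: val_inj; rewrite fE [RHS]/= !fE -morphM //.
  have -> : eval g (r x) * eval g (r y) = eval g (Div (r x) (Div One (r y))).
    by rewrite /= mul1g invgK.
  by apply/cosetE; rewrite /= !rK mul1g invgK.
exists (multiplicative_of fM).
have f_surj y : exists x, f x = y.
  have /morphimP[x _ Hx yE] := valP y.
  have /HP[w wx] := Hx; exists (eval u w); apply: val_inj.
  by rewrite fE [RHS]yE -wx; apply/cosetE; rewrite rK.
have [finv finvK] := choice f_surj; exists finv => // x.
move: (finvK (f x)) => /(congr1 val).
by rewrite !fE => /cosetE; rewrite !rK.
Qed.

(** * Coordinate kernels on a subgroup of a power *)

Section SubgroupsOfPowers.

Variables (S : finGroupType) (I : finType).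
Hypotheses (S_simple : simple [set: S]) (S_nonabelian : ~~ abelian [set: S]).
Local Notation P := {ffun I -> S}.
Implicit Types (H N : {group P}) (A : {set I}).

Definition coord (i : I) (x : P) : S := x i.

Lemma coordM i : {in [set: P] &, {morph coord i : x y / x * y}}.
Proof. by move=> x y _ _; rewrite /coord ffunE. Qed.

Canonical coord_morphism i := Morphism (coordM i).

(** The intersection of the coordinate kernels on [H] over [A]; a singleton [A] gives a single
    kernel. *)
Definition vanish H A := [set x in H | [forall i in A, x i == 1]].

Lemma vanishP H A x :
  reflect (x \in H /\ {in A, forall i, x i = 1}) (x \in vanish H A).
Proof.
rewrite inE; apply: (iffP andP) => -[Hx x1]; split=> //.
  by move=> i Ai; apply/eqP; exact: (forall_inP x1).
by apply/forall_inP=> i Ai; rewrite x1.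
Qed.

Lemma group_set_vanish H A : group_set (vanish H A).
Proof.
apply/group_setP; split=> [|x y /vanishP[Hx x1] /vanishP[Hy y1]]; apply/vanishP.
  by split=> [|i _]; rewrite ?group1 ?ffunE.
by split=> [|i Ai]; rewrite ?groupM // ffunE x1 // y1 // mulg1.
Qed.

Canonical vanish_group H A := Group (group_set_vanish H A).

Lemma vanish_normal H A : vanish H A <| H.
Proof.
apply/andP; split; apply/subsetP=> x; first by case/vanishP.
move=> Hx; rewrite inE; apply/subsetP=> _ /imsetP[y /vanishP[Hy y1] ->].
apply/vanishP; split=> [|i Ai]; first by rewrite groupJ.
by rewrite !ffunE y1 // mul1g mulVg.
Qed.

Lemma vanish_sub H A : vanish H A \subset H.
Proof. exact: normal_sub (vanish_normal H A). Qed.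

Definition full H i := coord i @* H == [set: S].

(** The image of [N] is normal in the simple group [S], and [x] shows that it is not trivial. *)
Lemma coord_normal_full H N i x :
  full H i -> N <| H -> x \in N -> x i != 1 -> coord i @* N = [set: S].
Proof.
move=> /eqP fullHi nNH Nx xi.
have nXS : coord i @* N <| [set: S] by rewrite -fullHi morphim_normal.
have /simpleP[_ /(_ _ nXS)[] //= N1] := S_simple.
suff: x i \in coord i @* N by rewrite N1 => /set1P x1; rewrite x1 eqxx in xi.
by apply/morphimP; exists x; rewrite ?inE.
Qed.

(* Kernels of surjections onto S behave like prime ideals, with commutators in
   the role of products, because [S, S] is not trivial. *)
Lemma vanish_prime H A j :
  full H j -> vanish H A \subset vanish H [set j] ->
  exists2 i, i \in A & vanish H [set i] \subset vanish H [set j].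
Proof.
move=> fullHj sub_j.
have [/exists_inP[i Ai ?]|/exists_inPn no_i] :=
  boolP [exists i in A, vanish H [set i] \subset vanish H [set j]].
  by exists i.
suff fullA : coord j @* vanish H A = [set: S].
  have: [set: S] \subset [1].
    rewrite -fullA; apply/subsetP=> _ /morphimP[x _ Ax ->].
    have /vanishP[_ x1] := subsetP sub_j _ Ax.
    exact/set1P/x1/set11.
  by have /simpleP[/eqP nt _] := S_simple; move=> /trivgP.
(* Induction on a bound for [#|A|]: as long as no kernel over [A] lies in that of [j], coordinate
   [j] maps [vanish H A] onto [S]. *)
elim: {A}_.+1 {-2}A (ltnSn #|A|) no_i {sub_j} => // n IHn A leAn no_i.
have [->|[i Ai]] := set_0Vmem A.
  rewrite -(eqP fullHj); congr (_ @* _); apply/setP=> x.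
  by apply/vanishP/idP=> [[]|Hx] //; split=> // i; rewrite inE.
have fullB : coord j @* vanish H (A :\ i) = [set: S].
  apply: IHn => [|k /setD1P[_ Ak]]; last exact: no_i.
  by rewrite (cardsD1 i) Ai in leAn.
have fulli : coord j @* vanish H [set i] = [set: S].
  have /subsetPn[x xi xj] := no_i _ Ai.
  apply: (coord_normal_full fullHj (vanish_normal _ _) xi).
  apply: contra xj => /eqP xj1; apply/vanishP; split=> [|k /set1P->] //.
  exact: (subsetP (vanish_sub _ _) _ xi).
(* At each coordinate of [A] one of the two entries of the commutator is trivial. *)
have comm_sub : [~: vanish H (A :\ i), vanish H [set i]] \subset vanish H A.
  rewrite gen_subG.
  apply/subsetP=> _ /imset2P[x y /vanishP[Hx x1] /vanishP[Hy y1] ->].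
  apply/vanishP; split=> [|k Ak]; first by rewrite groupR.
  rewrite !ffunE; have [->|ki] := eqVneq k i.
    by rewrite y1 ?set11 // invg1 !mul1g !mulg1 mulVg.
  by rewrite x1 ?inE ?ki // invg1 !mul1g !mulVg.
have /subsetPn[s _ s_nc] := S_nonabelian.
have [t _ st] : exists2 t, t \in [set: S] & [~ s, t] != 1.
  apply/exists_inP; apply: contraR s_nc => /exists_inPn st.
  by apply/centP=> t _; apply/commgP/negPn/st.
have: [~ s, t] \in coord j @* vanish H A.
  apply: (subsetP (morphimS _ comm_sub)).
  by rewrite morphimR ?subsetT //= fullB fulli mem_commg ?inE.
case/morphimP=> x _ Ax stx; apply: (coord_normal_full fullHj _ Ax).
  exact: vanish_normal.
by rewrite -[x j]stx.
Qed.

(** * Good coordinates and the splitting of a subgroup *)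

Definition good H := [set i | full H i].

(** The index of a coordinate kernel is the order of the image, at most that of [S], with equality
    for [j]. The inclusion bounds the index for [i] from below, so both indices agree. *)
Lemma good_vanish_eq H i j :
  full H j -> vanish H [set i] \subset vanish H [set j] ->
  full H i /\ vanish H [set j] \subset vanish H [set i].
Proof.
have kerE k : vanish H [set k] = 'ker_H (coord k).
  apply/setP=> x; apply/vanishP/setIP=> -[Hx x1]; split=> //.
    by apply/kerP; rewrite ?inE //; apply: x1; rewrite set11.
  by move=> l /set1P->; apply: (kerP (coord_morphism k) (in_setT x) x1).
have cardE k : #|coord k @* H| = #|H : vanish H [set k]|.
  by rewrite kerE indexgI card_morphim setTI.
move=> fullHj sub_ij.
have le_ji : #|H : vanish H [set j]| <= #|H : vanish H [set i]|.
  by rewrite dvdn_leq // indexgS.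
have fulli : full H i.
  by rewrite /full eqEcard subsetT /= -(eqP fullHj) !cardE.
split=> //; rewrite -(geq_leqif (subset_leqif_card sub_ij)).
rewrite -(leq_pmul2r (indexg_gt0 H (vanish H [set i]))).
rewrite Lagrange ?vanish_sub // -cardE (eqP fulli) -(eqP fullHj) cardE.
by rewrite Lagrange ?vanish_sub.
Qed.

(** A Chinese remainder argument: [J] is a minimal set of good coordinates whose kernels still cut
    out [vanish H (good H)], which makes these coordinates independent. *)
Lemma vanish_interpolation H :
  exists2 J : {set I}, vanish H J \subset vanish H (good H)
    & forall f : I -> S, exists2 x, x \in vanish H (~: good H)
        & {in J, forall j, x j = f j}.
Proof.
pose ok (J : {set I}) :=
  (J \subset good H) && (vanish H J \subset vanish H (good H)).
have [J /minsetP[/andP[Jgood JD] Jmin] _] :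
  {J | minset ok J & J \subset good H}.
  by apply: minset_exists; rewrite /ok !subxx.
exists J => // f.
have fullJ j : j \in J -> full H j by move=> /(subsetP Jgood); rewrite inE.
pose C j := vanish H (~: good H :|: J :\ j).
have fullC j : j \in J -> coord j @* C j = [set: S].
  move=> Jj; suff /subsetPn[x Cx xj] : ~~ (C j \subset vanish H [set j]).
    apply: (coord_normal_full (fullJ _ Jj) (vanish_normal _ _) Cx).
    apply: contra xj => /eqP xj1; apply/vanishP; split=> [|k /set1P->] //.
    exact: (subsetP (vanish_sub _ _) _ Cx).
  (* By primeness the kernel of a bad coordinate or of another point of [J] would lie in that of
     [j]. The former contradicts [good_vanish_eq]; the latter makes [j] redundant in the minimal
     [J]. *)
  apply/negP=> /(vanish_prime (fullJ _ Jj))[i iC sub_ij].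
  have [fulli sub_ji] := good_vanish_eq (fullJ _ Jj) sub_ij.
  move: iC; rewrite in_setU inE inE fulli /= => iJ.
  have JE : J :\ j = J.
    apply: Jmin (subsetDl _ _); rewrite /ok.
    rewrite (subset_trans _ Jgood) ?subsetDl //=.
    apply: subset_trans JD; apply/subsetP=> x /vanishP[Hx x1].
    apply/vanishP; split=> // k Jk; have [->|kj] := eqVneq k j; last first.
      by apply: x1; rewrite !inE kj.
    have: x \in vanish H [set j].
      apply: (subsetP sub_ij); apply/vanishP.
      by split=> // l /set1P->; apply: x1.
    by case/vanishP=> _; apply; rewrite set11.
  by have := Jj; rewrite -JE !inE eqxx.
(* Membership in [J] is kept under the existential so that [choice] gives a total function. On [J],
   [c j] takes the value [f j] at [j] and 1 at the other points, so the product interpolates [f]. *)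
have c_ex j : exists y : P, j \in J -> y \in C j /\ y j = f j.
  have [Jj|] := boolP (j \in J); last by exists 1.
  have: f j \in coord j @* C j by rewrite fullC ?inE.
  by case/morphimP=> x _ Cx fjE; exists x.
have [c cP] := choice c_ex; exists (\prod_(j in J) c j) => [|j Jj].
  apply: group_prod => j /cP[/vanishP[Hc c1] _]; apply/vanishP.
  by split=> // k bad_k; apply: c1; rewrite inE bad_k.
have -> : (\prod_(k in J) c k) j = \prod_(k in J) c k j.
  by apply: (big_morph (fun x : P => x j)) => [x y|]; rewrite ffunE.
rewrite (big_only1 j) //; first by case: (cP j Jj).
move=> k kj Jk; have [/vanishP[_ c1] _] := cP k Jk.
by apply: c1; rewrite !inE eq_sym kj Jj orbT.
Qed.

Lemma vanish_TI H A : vanish H (~: A) :&: vanish H A = 1.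
Proof.
apply/trivgP/subsetP=> x /setIP[/vanishP[_ x1C] /vanishP[_ x1]].
apply/set1P/ffunP=> i; rewrite [RHS]ffunE.
by have [?|?] := boolP (i \in A); [apply: x1 | apply: x1C; rewrite inE].
Qed.

(** Interpolating [x] on [J] by some [y] that is trivial at the bad coordinates leaves [y^-1 * x]
    trivial on [J], hence at all good ones. *)
Lemma vanish_dprod H :
  vanish H (~: good H) \x vanish H (good H) = H.
Proof.
have [J JD interp] := vanish_interpolation H.
have TI := vanish_TI H (good H).
have nB : vanish H (~: good H) <| H := vanish_normal _ _.
have nG : vanish H (good H) <| H := vanish_normal _ _.
rewrite dprodE //.
  apply/eqP; rewrite eqEsubset mul_subG ?vanish_sub //=; apply/subsetP=> x Hx.
  have [y By yx] := interp x.
  have Hy : y \in H := subsetP (vanish_sub _ _) _ By.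
  rewrite -(mulKVg y x) mem_mulg //; apply: (subsetP JD); apply/vanishP.
  split=> [|j Jj]; first by rewrite groupM ?groupV.
  by rewrite !ffunE yx // mulVg.
apply/commG1P/trivgP; rewrite -TI setIC subsetI commg_subl commg_subr.
by rewrite !(subset_trans (vanish_sub _ _)) ?normal_norm.
Qed.

(** Restriction to [J] is onto by interpolation, and injective because an element trivial on [J]
    falls into both factors, which meet trivially. *)
Lemma vanish_bad_isog H :
  exists n, vanish H (~: good H) \isog [set: {ffun 'I_n -> S}].
Proof.
have [J JD interp] := vanish_interpolation H.
exists #|J|.
pose f (x : P) : {ffun 'I_#|J| -> S} := [ffun k => x (enum_val k)].
have fM : {in vanish H (~: good H) &, {morph f : x y / x * y}}.
  by move=> x y _ _; apply/ffunP=> k; rewrite !ffunE.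
apply/isogP; exists (Morphism fM).
  apply/injmP=> x y Lx Ly /ffunP fxy.
  apply/eqP; rewrite eq_mulVg1 -in_set1 -[[set _]](vanish_TI H (good H)).
  rewrite inE groupM ?groupV //=; apply: (subsetP JD); apply/vanishP.
  split=> [|j Jj].
    have [[Hx _] [Hy _]] := (vanishP _ _ _ Lx, vanishP _ _ _ Ly).
    by rewrite groupM ?groupV.
  have:= fxy (enum_rank_in Jj j); rewrite !ffunE enum_rankK_in // => ->.
  by rewrite mulVg.
apply/setP=> g; rewrite inE; apply/morphimP.
(* [h] carries [g] over to [J] and takes the default value 1 elsewhere. *)
pose h i := if [pick k | enum_val k == i] is Some k then g k else 1.
have [x Lx xh] := interp h.
exists x => //.
apply/ffunP=> k; rewrite ffunE xh ?enum_valP // /h.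
by case: pickP => [l /eqP/enum_val_inj-> //|/(_ k)]; rewrite eqxx.
Qed.

(** Take [H] minimal with the same image modulo [N]. If [N :&: H] were nontrivial at a full [i], it
    would map onto [S] there, and correcting elements of [H] by it would make the proper subgroup
    [vanish H [set i]] a smaller cover. *)
Lemma minimal_cover H0 N :
  N <| H0 -> exists H, [/\ H \subset H0, H / N = H0 / N
    & forall i, full H i -> N :&: H \subset vanish H [set i]].
Proof.
move=> nNH0.
have [H /mingroupP[/andP[sHH0 /eqP HN] Hmin] _] :
  {H : {group P} | [min H | (H \subset H0) && (H / N == H0 / N)]
    & H \subset H0}.
  by apply: mingroup_exists; rewrite subxx /=.
exists H; split=> // i fulli; apply/subsetP=> x NHx; have [Nx Hx] := setIP NHx.
apply/vanishP; split=> // _ /set1P->; apply: contraTeq isT => xi.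
have nNHH : N :&: H <| H.
  by rewrite /normal subsetIr normsI ?normG // (subset_trans sHH0) ?normal_norm.
have fullN := coord_normal_full fulli nNHH NHx xi.
have HE : vanish H [set i] = H.
  apply: Hmin (vanish_sub _ _).
  rewrite (subset_trans (vanish_sub _ _)) //= -HN eqEsubset.
  rewrite morphimS ?vanish_sub //=.
  apply/subsetP=> _ /morphimP[y Ny Hy ->].
  have /morphimP[z _ /setIP[Nz Hz] yz] : y i \in coord i @* (N :&: H).
    by rewrite fullN ?inE.
  apply/morphimP; exists (z^-1 * y).
  - by rewrite groupM ?groupV // (subsetP (normG N)).
  - apply/vanishP; split=> [|k /set1P->]; first by rewrite groupM ?groupV.
    by rewrite !ffunE [y i]yz mulVg.
  - by rewrite /= coset_kerl ?groupV.
by have := Hx; rewrite -HE => /vanishP[_ x1]; rewrite x1 ?set11 ?eqxx in xi.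
Qed.

End SubgroupsOfPowers.

(** * Isomorphisms and quotients between group types *)

Lemma isomorphic_trans (G H K : groupType) :
  isomorphic G H -> isomorphic H K -> isomorphic G K.
Proof.
move=> [f f_bij] [g g_bij].
have gfM : {morph g \o f : x y / x * y} by move=> x y /=; rewrite !gmulfM.
by exists (multiplicative_of gfM); apply: bij_comp.
Qed.

Lemma isomorphic_refl (G : groupType) : isomorphic G G.
Proof.
have idM : {morph @id G : x y / x * y} by [].
by exists (multiplicative_of idM); exists id.
Qed.

Lemma isog_isomorphic (gT rT : finGroupType) :
  [set: gT] \isog [set: rT] -> isomorphic gT rT.
Proof.
case/isogP=> f /injmP f_inj fT.
have fM : {morph f : x y / x * y} by move=> x y; rewrite morphM ?inE.
exists (multiplicative_of fM); apply: inj_card_bij => [x y|].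
  by apply: f_inj; rewrite inE.
by rewrite -!cardsT -fT leq_morphim.
Qed.

Lemma Var_quotient (X : groupType -> Prop) (gT : finGroupType)
    (D N : {group gT}) :
  D \subset 'N(N) -> Var X [subg D]%type -> Var X [subg D / N]%type.
Proof.
move=> nND VD C C_var XC.
pose q (x : [subg D]) : [subg D / N] := subg (D / N) (coset N (val x)).
have Dq (x : [subg D]) : coset N (val x) \in D / N.
  by rewrite mem_quotient ?(valP x).
have nNx (x : [subg D]) : val x \in 'N(N) := subsetP nND _ (valP x).
have qE x : val (q x) = coset N (val x) by rewrite [LHS]subgK.
have qM : {morph q : x y / x * y}.
  by move=> x y; apply: val_inj; rewrite qE [RHS]/= !qE -morphM.
apply: (variety_quotient C_var (f := multiplicative_of qM)); last exact: VD.
move=> y; have /morphimP[x _ Dx yx] := valP y.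
by exists (subg D x); apply: val_inj; rewrite [LHS]qE [RHS]yx [val _]subgK.
Qed.

(** * Assembling the decomposition *)

Section Decomposition.

Variables (S : finGroupType) (I : finType).
Hypotheses (S_simple : simple [set: S]) (S_nonabelian : ~~ abelian [set: S]).
Local Notation P := {ffun I -> S}.
Implicit Types H N : {group P}.

(** An element trivial at the good coordinates is determined by the bad ones, whose images are
    proper subgroups of [S]. *)
Lemma Var_vanish_good H :
  Var (proper_subfactor S) [subg vanish H (good H)]%type.
Proof.
move=> C C_var C_sub; pose bad := {i : I | i \in ~: good H}.
(* The quotient by 1 gives the image the shape required by [proper_subfactor]. *)
pose F (i : bad) : groupType := [subg (coord (val i) @* H) / 1]%type.
pose f (x : [subg vanish H (good H)]) : group_product F :=
  fun i => subg (coord (val i) @* H / 1) (coset 1 (coord (val i) (val x))).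
have CF i : C (F i).
  apply: C_sub; exists (coord (val i) @* H)%G, 1%G; split.
  - exact: normal1.
  - by case=> fullHi _; have := valP i; rewrite !inE /full fullHi eqxx.
  - exact: isomorphic_refl.
have imH (x : [subg vanish H (good H)]) i : coord i (val x) \in coord i @* H.
  apply/morphimP; exists (val x); rewrite ?inE //.
  by have /vanishP[] := valP x.
have fE x i : val (f x i) = coset 1 (coord (val i) (val x)).
  by rewrite [LHS]subgK ?mem_quotient.
have fM : {morph f : x y / x * y}.
  move=> x y; apply: functional_extensionality_dep => i; apply: val_inj.
  by rewrite fE [RHS]/= !fE -morphM ?norm1 ?inE // -coordM ?inE.
have f_inj : injective f.
  move=> x y fxy; apply/val_inj/ffunP=> i.
  have [[_ x1] [_ y1]] := (vanishP _ _ _ (valP x), vanishP _ _ _ (valP y)).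
  have [good_i|bad_i] := boolP (i \in good H).
    by rewrite [LHS]x1 // [RHS]y1.
  have bi : i \in ~: good H by rewrite inE.
  have := fE y (exist _ i bi); rewrite -fxy fE.
  move/(injmP (@coset1_injm S)) => xy; apply: xy;
    exact: (subsetP (norms1 [set: S])).
apply: (variety_subgroup C_var (f := multiplicative_of fM) f_inj).
exact: variety_product.
Qed.

Lemma subfactor_of_power_decomposition H0 N :
  N <| H0 -> exists n (K : groupType), Var (proper_subfactor S) K /\
    isomorphic [subg H0 / N]%type ({ffun 'I_n -> S} * K)%type.
Proof.
move=> nNH0; have [H [sHH0 HN N_good]] := minimal_cover S_simple nNH0.
have [n LS] := vanish_bad_isog S_simple S_nonabelian H.
have LD := vanish_dprod S_simple S_nonabelian H.
set L := vanish H (~: good H) in LS LD; set D := vanish H (good H) in LD.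
have nNH : H \subset 'N(N) := subset_trans sHH0 (normal_norm nNH0).
have nND : D \subset 'N(N) := subset_trans (vanish_sub _ _) nNH.
have nNL : L \subset 'N(N) := subset_trans (vanish_sub _ _) nNH.
have sND : N :&: H \subset D.
  apply/subsetP=> x NHx; have [_ Hx] := setIP NHx; apply/vanishP; split=> // i.
  by rewrite inE => /N_good/subsetP/(_ _ NHx)/vanishP[_ ->]; rewrite ?set11.
exists n, [subg D / N]%type; split.
  by apply: Var_quotient; last exact: Var_vanish_good.
have [_ LD_H cLD TI] := dprodP LD.
(* [N :&: H] lies in [D], so [N] meets [L] trivially. *)
have LN : L \isog L / N.
  apply: quotient_isog => //; apply/trivgP; rewrite -TI subsetI subsetIr /=.
  by rewrite (subset_trans _ sND) // setISS ?vanish_sub.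
have LDN : (L / N) \x (D / N) = H0 / N.
  rewrite -HN -LD_H dprodE ?quotientMl ?quotient_cents //.
  apply/trivgP/subsetP=> _ /setIP[/morphimP[x nNx Lx ->] /morphimP[y nNy Dy]].
  move=> /rcoset_kercosetP-/(_ nNx nNy) /rcosetP[z Nz xzy].
  (* With [x = z * y], the factor [z] lies in [N :&: H], hence in [D], and so does [x]. *)
  suff: x \in L :&: D by rewrite TI => /set1P->; rewrite morph1 group1.
  rewrite inE Lx /= xzy groupM //; apply: (subsetP sND); rewrite inE Nz /=.
  rewrite -(mulgK y z) -xzy groupM ?groupV //.
    exact: (subsetP (vanish_sub _ _) _ Lx).
  exact: (subsetP (vanish_sub _ _) _ Dy).
apply: isog_isomorphic; apply: (isog_trans (H := H0 / N)).
  by rewrite isog_sym isog_subg.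
suff : H0 / N \isog setX [set: {ffun 'I_n -> S}] [set: [subg D / N]].
  by congr (_ \isog _); apply/setP=> x; rewrite !inE.
apply: (isog_dprod LDN (setX_dprod _ _)).
  apply: isog_trans (isog_setX1 _ [set: {ffun 'I_n -> S}]).
  by apply: isog_trans LS; rewrite isog_sym.
by apply: isog_trans (isog_set1X _ [subg D / N]); apply: isog_subg.
Qed.

End Decomposition.

Theorem lemma2p6 (S : finGroupType) (S_simple : simple [set: S])
    (S_nonabelian : ~~ abelian [set: S])
    (G : groupType) (G_fg : finitely_generated G)
    (G_in_V : Var (fun H : groupType => H = S) G) :
  exists (n : nat) (K : groupType),
    Var (proper_subfactor S) K /\
    isomorphic G ({ffun 'I_n -> S} * K)%type.
Proof.
have [|I [H [N [nNH GHN]]]] := @fg_laws_finite S G G_fg.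
  (* The groups satisfying the laws of [S] form a variety containing [S], hence contain [G]. *)
  by move=> k; apply: G_in_V (variety_laws _ _) _ => H -> w.
have [n [K [VK HNK]]] :=
  subfactor_of_power_decomposition S_simple S_nonabelian nNH.
by exists n, K; split=> //; apply: isomorphic_trans HNK.
Qed.
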